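(* Let $\alpha\sim G$ with $G$ a probability distribution supported on $[0,1]$, let $m_k=\mathbb{E}_{\alpha\sim G}[\alpha^k]$, and let $\ell_k=\ell_0-\ln m_k$ with $\ell_0=\ln\frac{p_0}{1-p_0}$. For any $G$, $k\mapsto\ell_k$ is concave on $k\ge0$; it is strictly concave unless $G$ is degenerate. Moreover the per-gate evidence increments $$\Delta_{j+1}:=\ell_{j+1}-\ell_j=\ln\frac{m_j}{m_{j+1}}=-\ln\mathbb{E}_{(j)}[\alpha],\qquad dG_{(j)}\propto\alpha^{j}\,dG,$$ are strictly decreasing, with $\mathbb{E}_{(j)}[\alpha]\uparrow\operatorname{ess\,sup}\alpha$. Consequently the line through the first gate (the Odds Law line), $\ell_0+k\Delta_1$, upper-bounds $\ell_k$ for all $k\ge1$, with equality only at $k\in\{0,1\}$.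
   Context: A candidate answer is correct with prior probability $p_0$ and is passed through $k$ verification gates; it is returned only if all $k$ accept. Correct answers are always accepted. An erroneous answer carries a latent false-accept rate $\alpha\sim G$, and given $\alpha$ the gate verdicts are i.i.d. Bernoulli$(\alpha)$ (1 meaning accept). Then $\ell_k=\ell_0-\ln m_k$ is the posterior log-odds that the answer is correct given that all $k$ gates accept. $G_{(j)}$ is the $\alpha^j$-tilted probability distribution, $\mathbb{E}_{(j)}$ denotes expectation under $G_{(j)}$, and $\operatorname{ess\,sup}\alpha$ is the essential supremum of $\alpha$ under $G$. ''Degenerate'' means a point mass. The Odds Law is the statement that log-odds grow linearly in the number of gates, as they do when gates are conditionally independent with a constant false-accept rate.
   Formalization: Strict concavity and strictly decreasing increments are claimed only if G is not carried by a set {0,c} (they fail there: Δ_2=Δ_3); equality only at k∈{0,1} is claimed for nondegenerate G; the clauses on Δ formulas and E_(j) exclude the point mass at 0, where G_(j) is undefined. *)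

(* Defs.v *)
From HB Require Import structures.
From mathcomp Require Import all_boot all_order all_algebra.
From mathcomp Require Import all_classical all_reals all_analysis.
From mathcomp Require Import measurable_realfun.

Set Implicit Arguments.
Unset Strict Implicit.
Unset Printing Implicit Defensive.

Import Order.TTheory GRing.Theory Num.Theory.
Import numFieldNormedType.Exports.

Local Open Scope classical_set_scope.
Local Open Scope ring_scope.

Section extended_concavity.
Context {R : realType}.
Local Open Scope ereal_scope.

(* Concavity of an extended-real valued function on a convex set D; meant for
   functions that do not take the value -oo, so that no sum +oo - oo occurs. *)
Definition concave_on (D : set R) (f : R -> \bar R) : Prop :=
  forall (x y t : R), D x -> D y -> (0 <= t <= 1)%R ->
    t%:E * f x + (1 - t)%:E * f y <= f (t * x + (1 - t) * y)%R.

Definition strictly_concave_on (D : set R) (f : R -> \bar R) : Prop :=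
  forall (x y t : R), D x -> D y -> x != y -> (0 < t < 1)%R ->
    t%:E * f x + (1 - t)%:E * f y < f (t * x + (1 - t) * y)%R.

End extended_concavity.

Section gates.
Context {R : realType}.
Local Open Scope ereal_scope.

Definition logit (p : R) : R := ln (p / (1 - p)).

(* The exponent k is a real number, the number of gates being k = n%:R.
   Recall 0 `^ 0 = 1, hence moment G 0 = 1 even if G has an atom at 0. *)
Definition moment (G : probability R R) (k : R) : \bar R :=
  'E_G[fun a : R => (a `^ k)%R].

(* lne 0 = -oo: when G is the point mass at 0, ell G p0 k = +oo for k > 0. *)
Definition ell (G : probability R R) (p0 k : R) : \bar R :=
  (logit p0)%:E - lne (moment G k).

Lemma ell0 (G : probability R R) (p0 : R) : ell G p0 0%R = (logit p0)%:E.
Proof.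
rewrite /ell /moment (_ : (fun a : R => (a `^ 0)%R) = cst 1%R); last first.
  by apply/funext => a; rewrite powRr0.
by rewrite expectation_cst lne1 sube0.
Qed.

(* Only used for n > 0, where it is ell_n - ell_(n - 1). *)
Definition Delta (G : probability R R) (p0 : R) (n : nat) : \bar R :=
  ell G p0 n%:R - ell G p0 n.-1%:R.

Definition degenerate (G : probability R R) : Prop :=
  exists c : R, G [set c] = 1.

(* G is carried by {0, c} for some c, i.e. it is a point mass up to an atom at
   0. Then moment G k = G {c} * c^k for k > 0 (when c <> 0), so that ell is
   affine on ]0, +oo[, hence not strictly concave, even if G {0} > 0. *)
Definition degenerate_off0 (G : probability R R) : Prop :=
  exists c : R, G [set 0%R; c] = 1.

(* The unnormalized measure alpha^j dG. *)
Definition tilt_weight (G : probability R R) (j : nat) (A : set R) : \bar R :=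
  \int[G]_(a in A) (a `^ j%:R)%R%:E.

Section tilt_weight_measure.
Variables (G : probability R R) (j : nat).

Let tilt_weight0 : tilt_weight G j set0 = 0.
Proof. by rewrite /tilt_weight integral_set0. Qed.

Let tilt_weight_ge0 A : 0 <= tilt_weight G j A.
Proof. by apply: integral_ge0 => a _; rewrite lee_fin powR_ge0. Qed.

Let tilt_weight_sigma_additive : semi_sigma_additive (tilt_weight G j).
Proof.
move=> F mF tF mUF; rewrite /tilt_weight ge0_integral_bigcup//=.
- by apply: is_cvg_ereal_nneg_natsum_cond => n _ _; exact: tilt_weight_ge0.
- by apply/measurable_EFinP/measurable_funTS; exact: measurable_powR.
- by move=> a _; rewrite lee_fin powR_ge0.
Qed.

HB.instance Definition _ := isMeasure.Build _ _ _ (tilt_weight G j)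
  tilt_weight0 tilt_weight_ge0 tilt_weight_sigma_additive.

End tilt_weight_measure.

Lemma tilt_weightT (G : probability R R) (j : nat) :
  tilt_weight G j setT = moment G j%:R.
Proof. by rewrite /moment unlock. Qed.

(* The normalization divides by moment G j; the default value G of mnormalize
   is only taken if this moment is 0, i.e. if G is the point mass at 0. *)
Definition tilt (G : probability R R) (j : nat) : probability R R :=
  mnormalize (tilt_weight G j) G.

Definition tilted_mean (G : probability R R) (j : nat) : \bar R :=
  'E_(tilt G j)[fun a : R => a].

End gates.

(* Main.v *)
(** Everything follows from the log-convexity of k |-> m_k together with its
    equality case.  For x <> y and z = t x + (1 - t) y with 0 < t < 1, weighted
    AM-GM applied pointwise to u = a^x / m_x and v = a^y / m_y gives
    a^z / (m_x^t m_y^(1-t)) = u^t v^(1-t) <= t u + (1 - t) v; integrating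
    yields m_z <= m_x^t m_y^(1-t), and equality forces a^x m_y = a^y m_x almost
    everywhere, i.e. G is carried by {0, c}, or by {c} alone when x = 0.

    The tilted means are the ratios m_(j+1) / m_j, nondecreasing by
    log-convexity and bounded by the essential supremum.  If they were bounded
    by r and G gave positive mass to ]c, +oo[ with c > r, then
    c^n G ]c, +oo[ <= m_n <= r^n for all n, which is absurd for n large. *)
Require Import Defs.
From mathcomp Require Import all_boot all_order all_algebra.
From mathcomp Require Import all_classical all_reals all_analysis.
From mathcomp Require Import measurable_realfun ess_sup_inf.
From mathcomp Require Import ring lra.

Set Implicit Arguments.
Unset Strict Implicit.
Unset Printing Implicit Defensive.

Import Order.TTheory GRing.Theory Num.Theory.
Import numFieldNormedType.Exports.

Local Open Scope classical_set_scope.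
Local Open Scope ring_scope.

Import HBNNSimple.

(** * Integration against a measure with a density *)

Local Open Scope ereal_scope.

(** Monotone convergence along the simple approximations [h n] of [f] reduces both sides to simple
    functions, then by additivity to level sets, where [nuE] applies. *)
Lemma ge0_integral_density (d : measure_display) (T : measurableType d)
    (R : realType) (mu nu : {measure set T -> \bar R}) (w : T -> R)
    (mw : measurable_fun setT w) (w0 : forall x, (0 <= w x)%R)
    (nuE : forall A, measurable A -> nu A = \int[mu]_(x in A) (w x)%:E)
    (f : T -> \bar R) (mf : measurable_fun setT f) (f0 : forall x, 0 <= f x) :
  \int[nu]_x f x = \int[mu]_x (f x * (w x)%:E).
Proof.
pose h := nnsfun_approx measurableT mf.
have mwE : measurable_fun setT (EFin \o w) by exact/measurable_EFinP.
transitivity (limn (fun n => \int[nu]_x (h n x)%:E)).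
  rewrite -monotone_convergence//=.
  - apply: eq_integral => x _; apply/esym/cvg_lim => //=.
    exact: cvg_nnsfun_approx.
  - by move=> n; exact/measurable_EFinP/measurable_funTS.
  - by move=> n x _; rewrite lee_fin.
  - by move=> x _ m n mn; rewrite lee_fin; exact/lefP/nd_nnsfun_approx.
transitivity (limn (fun n => \int[mu]_x ((h n x)%:E * (w x)%:E))); last first.
  rewrite -monotone_convergence//=.
  - apply: eq_integral => x _; apply/cvg_lim => //=.
    by apply: cvgeZr => //; exact: cvg_nnsfun_approx.
  - move=> n; apply: emeasurable_funM => //.
    exact/measurable_EFinP/measurable_funTS.
  - by move=> n x _; rewrite mule_ge0 ?lee_fin.
  - move=> x _ m n mn; rewrite lee_wpmul2r ?lee_fin//.
    exact/lefP/nd_nnsfun_approx.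
apply: congr_lim; apply/funext => n.
under [LHS]eq_integral do rewrite fimfunE -fsumEFin//.
rewrite [LHS]ge0_integral_fsum//; last 2 first.
  - by move=> r; exact/measurable_EFinP/measurableT_comp.
  - by move=> r x _; rewrite EFinM nnfun_muleindic_ge0.
under [RHS]eq_integral.
  move=> x _; rewrite fimfunE -fsumEFin// ge0_mule_fsuml; last first.
    by move=> r; rewrite EFinM nnfun_muleindic_ge0.
  over.
rewrite [RHS]ge0_integral_fsum//; last 2 first.
  - move=> r; apply: emeasurable_funM => //.
    exact/measurable_EFinP/measurableT_comp.
  - move=> r x _; rewrite mule_ge0 ?lee_fin//.
    exact: nnfun_muleindic_ge0.
apply: eq_fsbigr => r _.
have mE : measurable (h n @^-1` [set r]) by exact: measurable_sfunP.
rewrite integralZl_indic_nnsfun// integral_indic// setIT nuE//.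
(* For [r < 0] the level set is empty because [h n] is nonnegative; for [r >= 0] the factor can be
   moved inside the integral. *)
have [r0|r0] := ltP r 0%R.
  rewrite preimage_nnfun0// integral_set0 mule0.
  by under eq_integral do rewrite indic0 mulr0 mul0e; rewrite integral0.
rewrite -ge0_integralZl//; last 2 first.
  - exact: measurable_funS mwE.
  - by move=> x _; rewrite lee_fin.
rewrite integral_mkcond; apply: eq_integral => x _.
rewrite patchE indicE; case: ifPn => _; first by rewrite mulr1.
by rewrite mulr0 mul0e.
Qed.

Local Close Scope ereal_scope.

(** * Weighted AM-GM with its equality case *)

(** For distinct positive [u], [v] with weighted geometric mean [g] and [w = ln u - ln v], one has
    [u = g * expR ((1 - t) * w)] and [v = g * expR (- t * w)]. The strict bound [1 + x < expR x] is
    applied to both exponentials; the linear terms cancel in the weighted sum. *)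
Lemma powR_AMGM (R : realType) (u v t : R) : 0 <= u -> 0 <= v -> 0 < t < 1 ->
  u `^ t * v `^ (1 - t) <= t * u + (1 - t) * v ?= iff (u == v).
Proof.
move=> u0 v0 /andP[t0 t1].
have t10 : 0 < 1 - t by rewrite subr_gt0.
have [->|uneq0] := eqVneq u 0.
  rewrite (powR0 (lt0r_neq0 t0)) mul0r mulr0 add0r; split.
    by rewrite mulr_ge0// ltW.
  by rewrite eq_sym mulf_eq0 (gt_eqF t10) /= eq_sym.
have [->|vneq0] := eqVneq v 0.
  rewrite (powR0 (lt0r_neq0 t10)) !mulr0 addr0; split.
    by rewrite mulr_ge0// ltW.
  by rewrite eq_sym mulf_eq0 (gt_eqF t0).
have {u0}u0 : 0 < u by rewrite lt_neqAle eq_sym uneq0.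
have {v0}v0 : 0 < v by rewrite lt_neqAle eq_sym vneq0.
have [->|uv] := eqVneq u v.
  rewrite -powRD ?vneq0 ?implybT// addrC subrK powRr1 ?ltW// -mulrDl.
  by rewrite addrC subrK mul1r; split => //; rewrite eqxx.
have lt_amgm : u `^ t * v `^ (1 - t) < t * u + (1 - t) * v.
  set g := u `^ t * v `^ (1 - t).
  have g0 : 0 < g by rewrite mulr_gt0 ?powR_gt0.
  pose w := ln u - ln v.
  have w0 : w != 0.
    rewrite subr_eq0; apply: contra uv => /eqP/ln_inj.
    by rewrite !posrE => /(_ u0 v0) ->.
  have gE : g = expR (t * ln u + (1 - t) * ln v).
    by rewrite expRD /g /powR (negbTE uneq0) (negbTE vneq0).
  have uE : u = g * expR ((1 - t) * w).
    by rewrite gE -expRD -{1}(lnK u0); congr expR; rewrite /w; ring.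
  have vE : v = g * expR (- t * w).
    by rewrite gE -expRD -{1}(lnK v0); congr expR; rewrite /w; ring.
  have h1 : 1 + (1 - t) * w < expR ((1 - t) * w).
    by apply: expR_gt1Dx; rewrite mulf_neq0 ?(lt0r_neq0 t10).
  have h2 : 1 + - t * w < expR (- t * w).
    by apply: expR_gt1Dx; rewrite mulf_neq0 ?oppr_eq0 ?(lt0r_neq0 t0).
  rewrite uE [in ltRHS]vE.
  have -> : t * (g * expR ((1 - t) * w)) + (1 - t) * (g * expR (- t * w)) =
    g * (t * expR ((1 - t) * w) + (1 - t) * expR (- t * w)) by ring.
  rewrite -[ltLHS]mulr1 ltr_pM2l//.
  rewrite [ltLHS](_ : _ = t * (1 + (1 - t) * w) + (1 - t) * (1 + - t * w));
    last by ring.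
  by apply: ltrD; rewrite ltr_pM2l.
by split; [exact: ltW | rewrite lt_eqF].
Qed.

(** * Real-valued moments on the unit interval *)

(** On [[0, 1]], which carries [G], the integrand is bounded for [k >= 0], so a real integral can
    stand in for the extended-valued [moment]. *)
Definition mom (R : realType) (G : probability R R) (k : R) : R :=
  \int[G]_(a in `[0, 1]) (a `^ k).

Lemma ae_prob1 (d : measure_display) (T : measurableType d) (R : realType)
    (P : probability T R) (A : set T) : measurable A ->
  {ae P, forall x, A x} <-> P A = 1%E.
Proof.
move=> mA; split.
  move=> /negligibleP PA0; have {}PA0 := PA0 (measurableC mA).
  by rewrite -[A]setCK probability_setC ?PA0 ?sube0//; exact: measurableC.
move=> PA1; apply/negligibleP; first exact: measurableC.
by have := probability_setC P mA; rewrite PA1 subee.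
Qed.

Lemma integrable_powR (R : realType) (G : probability R R) (k : R) : 0 <= k ->
  G.-integrable `[0, 1] (EFin \o (fun a => a `^ k)).
Proof.
move=> k0; apply: measurable_bounded_integrable => //.
- by rewrite (le_lt_trans (probability_le1 _ _))// ltry.
- by apply: measurable_funTS; exact: measurable_powR.
- exists 1; split; first exact: num_real.
  move=> x x1 a /=; rewrite in_itv/= => /andP[a0 a1].
  rewrite ger0_norm ?powR_ge0// (le_trans _ (ltW x1))//.
  have <- : 1 `^ k = 1 :> R by rewrite powR1.
  by rewrite ge0_ler_powR// nnegrE.
Qed.

Lemma moment_mom (R : realType) (G : probability R R) (k : R) :
  G `[0, 1]%classic = 1%E -> 0 <= k -> moment G k = (mom G k)%:E.
Proof.
move=> hG k0; rewrite /moment /mom /Rintegral fineK; last first.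
  exact: integrable_fin_num (integrable_powR G k0).
rewrite unlock.
rewrite (@ge0_negligible_integral _ _ _ _ _ (~` (`[0, 1]%classic : set R)))//.
- by rewrite setTD setCK.
- exact: measurableC.
- by apply/measurable_EFinP; exact: measurable_powR.
- by move=> a _; rewrite lee_fin powR_ge0.
- by rewrite [LHS]probability_setC// hG subee.
Qed.

Lemma mom_ge0 (R : realType) (G : probability R R) (k : R) : 0 <= mom G k.
Proof. by apply: Rintegral_ge0 => a _; exact: powR_ge0. Qed.

Lemma Rintegral_eq0_ae (d : measure_display) (T : measurableType d)
    (R : realType) (mu : {measure set T -> \bar R}) (D : set T) (f : T -> R) :
  measurable D -> mu.-integrable D (EFin \o f) ->
  (forall x, D x -> 0 <= f x) -> \int[mu]_(x in D) f x = 0 ->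
  {ae mu, forall x, D x -> f x = 0}.
Proof.
move=> mD intf f0 int0.
have : ae_eq mu D (EFin \o f) (cst 0%E).
  apply/ae_eq_integral_abs => //; first by case/integrableP : intf.
  rewrite (eq_integral (EFin \o f)); last first.
    by move=> x; rewrite inE => Dx; rewrite /= ger0_norm ?f0.
  rewrite -[LHS]fineK; last exact: integrable_fin_num.
  by rewrite -/(Rintegral _ _ _) int0.
by apply: filterS => x /[apply] -[].
Qed.

Lemma powR_div (R : realType) (p q s : R) : 0 <= p -> 0 < q ->
  (p / q) `^ s = p `^ s / q `^ s.
Proof.
move=> p0 q0; have q0' := ltW q0.
rewrite powRM ?invr_ge0//; congr (_ * _).
by rewrite -powR_inv1// powRAC powR_inv1// powR_ge0.
Qed.

(** * Log-convexity of the moments and its equality case *)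

(** This is Hölder's inequality with exponents [1/t] and [1/(1 - t)], derived from pointwise AM-GM
    so that the equality case can be read off from the vanishing of the gap. *)
Lemma mom_interpolation (R : realType) (G : probability R R) (x y t : R) :
  0 <= x -> 0 <= y -> x != y -> 0 < t < 1 -> 0 < mom G x -> 0 < mom G y ->
  mom G (t * x + (1 - t) * y) <= mom G x `^ t * mom G y `^ (1 - t) /\
  (mom G (t * x + (1 - t) * y) = mom G x `^ t * mom G y `^ (1 - t) ->
   {ae G, forall a, `[0, 1]%classic a ->
     a `^ x * mom G y = a `^ y * mom G x}).
Proof.
move=> x0 y0 xy t01 Mx0 My0; have /andP[t0 t1] := t01.
have t10 : 0 < 1 - t by rewrite subr_gt0.
set z := t * x + (1 - t) * y; set g := _ `^ t * _.
have z0 : 0 < z.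
  have tx0 : 0 <= t * x by rewrite mulr_ge0// ltW.
  have ty0 : 0 <= (1 - t) * y by rewrite mulr_ge0// ltW.
  rewrite lt_neqAle addr_ge0// andbT eq_sym paddr_eq0// !mulf_eq0.
  rewrite (gt_eqF t0) (gt_eqF t10)/=.
  by apply: contra xy => /andP[/eqP -> /eqP ->].
have g0 : 0 < g by rewrite mulr_gt0 ?powR_gt0.
have mU : measurable (`[0, 1]%classic : set R) by [].
pose u a := a `^ x / mom G x; pose v a := a `^ y / mom G y.
(* [D] is the AM-GM gap of [u] and [v], both normalized to integral 1; hence it is nonnegative on
   [[0, 1]] with integral [1 - mom G z / g]. *)
pose D (a : R) := t * u a + (1 - t) * v a - a `^ z / g.
have iu : G.-integrable `[0, 1] (EFin \o u).
  apply: eq_integrable (integrableZr mU (mom G x)^-1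
    (integrable_powR G x0)) => //.
have iv : G.-integrable `[0, 1] (EFin \o v).
  apply: eq_integrable (integrableZr mU (mom G y)^-1
    (integrable_powR G y0)) => //.
have iz : G.-integrable `[0, 1] (EFin \o (fun a => a `^ z / g)).
  apply: eq_integrable (integrableZr mU g^-1
    (integrable_powR G (ltW z0))) => //.
have itu : G.-integrable `[0, 1] (EFin \o (fun a => t * u a)).
  by apply: eq_integrable (integrableZl mU t iu).
have itv : G.-integrable `[0, 1] (EFin \o (fun a => (1 - t) * v a)).
  by apply: eq_integrable (integrableZl mU (1 - t) iv).
have ituv : G.-integrable `[0, 1] (EFin \o (fun a => t * u a + (1 - t) * v a)).
  by apply: eq_integrable (integrableD mU itu itv).
have iD : G.-integrable `[0, 1] (EFin \o D).
  by apply: eq_integrable (integrableB mU ituv iz).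
have intD : \int[G]_(a in `[0, 1]) D a = 1 - mom G z / g.
  have ix := integrable_powR G x0; have iy := integrable_powR G y0.
  have iz' := integrable_powR G (ltW z0).
  rewrite RintegralB// RintegralD// !RintegralZl// !RintegralZr//.
  rewrite -/(mom G x) -/(mom G y) -/(mom G z).
  rewrite !divff ?(lt0r_neq0 Mx0) ?(lt0r_neq0 My0)// !mulr1.
  by rewrite [t + _]addrC subrK.
have powz a : 0 <= a -> a `^ z / g = u a `^ t * v a `^ (1 - t).
  move=> a0; rewrite !powR_div ?powR_ge0// mulrACA -invfM -!powRrM.
  rewrite [x * t]mulrC [y * _]mulrC -powRD -?/z ?(gt_eqF z0)//.
have D0 a : `[0, 1]%classic a -> 0 <= D a ?= iff (u a == v a).
  rewrite /= in_itv/= => /andP[a0 _].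
  have [le eqv] := powR_AMGM (divr_ge0 (powR_ge0 a x) (ltW Mx0))
    (divr_ge0 (powR_ge0 a y) (ltW My0)) t01.
  by split; rewrite /D powz// ?subr_ge0// eq_sym subr_eq0 eq_sym.
split.
  rewrite -[leRHS]mul1r -ler_pdivrMr// -subr_ge0 -intD.
  by apply: Rintegral_ge0 => a /D0[].
move=> Mz; have : {ae G, forall a, `[0, 1]%classic a -> D a = 0}.
  apply: Rintegral_eq0_ae => //; first by move=> a /D0[].
  by rewrite intD Mz divff ?gt_eqF// subrr.
apply: filterS => a Da a01; have {}Da := Da a01.
have [_] := D0 a a01; rewrite Da eqxx => /esym/eqP.
by move/eqP; rewrite /u /v eqr_div ?(lt0r_neq0 Mx0) ?(lt0r_neq0 My0)// => /eqP.
Qed.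

Lemma ae_unit (R : realType) (G : probability R R) :
  G `[0, 1]%classic = 1%E -> {ae G, forall a, `[0, 1]%classic a}.
Proof. by move=> hG; exact/ae_prob1. Qed.

Lemma mom_gt0 (R : realType) (G : probability R R) (k : R) :
  G `[0, 1]%classic = 1%E -> G [set 0] <> 1%E -> 0 <= k -> 0 < mom G k.
Proof.
move=> hG G0 k0; rewrite lt_neqAle mom_ge0 andbT eq_sym; apply/eqP => Mk0.
apply: G0; apply/ae_prob1 => //.
have := Rintegral_eq0_ae (measurable_itv _) (integrable_powR G k0)
  (fun a _ => powR_ge0 a k) Mk0.
by apply: filterS2 (ae_unit hG) => a Ua /(_ Ua) /powR_eq0_eq0.
Qed.

Lemma mom0 (R : realType) (G : probability R R) :
  G `[0, 1]%classic = 1%E -> mom G 0 = 1.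
Proof.
move=> hG; rewrite /mom; under eq_Rintegral do rewrite powRr0.
by rewrite Rintegral_cst// [X in fine X]hG mulr1.
Qed.

Lemma degenerate_off0_powR (R : realType) (G : probability R R) (x y p q : R) :
  G `[0, 1]%classic = 1%E -> x != y -> 0 < p -> 0 < q ->
  {ae G, forall a, `[0, 1]%classic a -> a `^ x * q = a `^ y * p} ->
  degenerate_off0 G /\ (x = 0 -> degenerate G).
Proof.
move=> hG xy p0 q0 aeG.
pose c := (p / q) `^ (x - y)^-1.
have ac a : 0 < a -> a `^ x * q = a `^ y * p -> a = c.
  move=> a0 e; have ay0 : a `^ y != 0 by rewrite gt_eqF// powR_gt0.
  rewrite /c (_ : p / q = a `^ (x - y)); last first.
    rewrite powRB ?(gt_eqF a0) ?implybT//.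
    by apply/eqP; rewrite eqr_div ?(gt_eqF q0)// mulrC -e.
  by rewrite -powRrM divff ?subr_eq0// powRr1// ltW.
split.
  exists c; apply/ae_prob1; first by apply: measurableU.
  move: (ae_unit hG) aeG; apply: filterS2 => a Ua /(_ Ua) e.
  move: Ua; rewrite /= in_itv/= le_eqVlt => /andP[/predU1P[<-|a0] _].
    by left.
  by right; exact: ac.
move=> x0; exists c; apply/ae_prob1 => //.
move: (ae_unit hG) aeG; apply: filterS2 => a Ua /(_ Ua) e.
move: Ua; rewrite /= in_itv/= le_eqVlt => /andP[/predU1P[a0|a0] _].
  move: e; rewrite -a0 x0 powRr0 mul1r powR0; last by rewrite eq_sym -x0.
  by rewrite mul0r => q00; move: q0; rewrite q00 ltxx.
exact: ac.
Qed.

(** Logarithm of the interpolation inequality. It serves for general concavity, at [j], [j + 2] with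
    weight 1/2 for the increments, and with left endpoint [0] for the line through the first gate,
    where equality yields full degeneracy. *)
Lemma ln_mom_convex (R : realType) (G : probability R R) (x y t : R) :
  G `[0, 1]%classic = 1%E -> G [set 0] <> 1%E ->
  0 <= x -> 0 <= y -> x != y -> 0 < t < 1 ->
  ln (mom G (t * x + (1 - t) * y)) <=
    t * ln (mom G x) + (1 - t) * ln (mom G y) /\
  (ln (mom G (t * x + (1 - t) * y)) =
     t * ln (mom G x) + (1 - t) * ln (mom G y) ->
   degenerate_off0 G /\ (x = 0 -> degenerate G)).
Proof.
move=> hG G0 x0 y0 xy t01; have /andP[t0 t1] := t01.
have Mx0 := mom_gt0 hG G0 x0; have My0 := mom_gt0 hG G0 y0.
have z0 : 0 <= t * x + (1 - t) * y.
  by rewrite addr_ge0// mulr_ge0// ?subr_ge0 ltW.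
have Mz0 := mom_gt0 hG G0 z0.
have [le_int eq_int] := mom_interpolation x0 y0 xy t01 Mx0 My0.
rewrite -!ln_powR -lnM ?posrE ?powR_gt0//; split.
  by rewrite ler_ln// posrE mulr_gt0 ?powR_gt0.
move=> /ln_inj; rewrite !posrE mulr_gt0 ?powR_gt0// => /(_ Mz0 isT) /eq_int.
exact: degenerate_off0_powR.
Qed.

(** * Log-odds and tilted means in terms of real moments *)

Lemma ell_ln_mom (R : realType) (G : probability R R) (p0 k : R) :
  G `[0, 1]%classic = 1%E -> G [set 0] <> 1%E -> 0 <= k ->
  ell G p0 k = (logit p0 - ln (mom G k))%:E.
Proof.
move=> hG G0 k0; rewrite /ell moment_mom// lne_EFin ?EFinB//.
exact: mom_gt0.
Qed.

Lemma ell_dirac0 (R : realType) (G : probability R R) (p0 k : R) :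
  G `[0, 1]%classic = 1%E -> G [set 0] = 1%E -> 0 < k ->
  ell G p0 k = +oo%E.
Proof.
move=> hG G0 k0; have aeG0 : {ae G, forall a, [set 0] a} by exact/ae_prob1.
rewrite /ell (_ : moment G k = 0%E); first by rewrite le0_lneNy.
rewrite /moment unlock (ae_eq_integral (cst 0%E)) ?integral0//.
- by apply/measurable_EFinP; exact: measurable_powR.
- by apply: filterS aeG0 => a /= -> _; rewrite powR0// gt_eqF.
Qed.

(** The tilted law has density [w = a^j / m_j] with respect to [G], so its mean is the integral of
    [a * w], that is [m_(j+1) / m_j]. *)
Lemma tilted_mean_mom (R : realType) (G : probability R R) (j : nat) :
  G `[0, 1]%classic = 1%E -> G [set 0] <> 1%E ->
  tilted_mean G j = (mom G j.+1%:R / mom G j%:R)%:E.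
Proof.
move=> hG G0; have Mj0 := mom_gt0 hG G0 (ler0n R j).
pose U : set R := `[0, 1]%classic.
have mU : measurable U by exact: measurable_itv.
have GU : G (~` U) = 0%E by rewrite probability_setC// hG subee.
pose w (a : R) := a `^ j%:R / mom G j%:R.
have w0 a : 0 <= w a by rewrite divr_ge0 ?powR_ge0 ?ltW.
have mw : measurable_fun setT w.
  by apply: measurable_funM => //; exact: measurable_powR.
have mabs : measurable_fun setT (fun a : R => `|a|) by exact: normr_measurable.
have tiltE (A : set R) : measurable A ->
    tilt G j A = (\int[G]_(a in A) (w a)%:E)%E.
  move=> mA; rewrite /tilt /= /mnormalize/= tilt_weightT moment_mom//.
  (* The total mass is nonzero, so [mnormalize] does not take its default value. *)
  rewrite eqe (gt_eqF Mj0)/= /tilt_weight -ge0_integralZr//.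
  - by apply/measurable_EFinP/measurable_funTS; exact: measurable_powR.
  - by move=> a _; rewrite lee_fin powR_ge0.
  - by rewrite lee_fin invr_ge0 ltW.
rewrite /tilted_mean unlock.
(* The density formula asks for a function nonnegative everywhere; the identity agrees with the
   absolute value on [[0, 1]], whose complement is null for the tilted law. *)
rewrite (ae_eq_integral (fun a : R => `|a|%:E))//; last 2 first.
- exact/measurable_EFinP.
- exists (~` U); split; first exact: measurableC.
    apply: etrans (tiltE _ (measurableC mU)) _.
    apply: null_set_integral => //; first exact: measurableC.
    by apply/measurable_EFinP/measurable_funTS.
  move=> a /= na Ua; apply: na => _; move: Ua.
  by rewrite /U /= in_itv/= => /andP[a0 _]; rewrite ger0_norm.
rewrite (ge0_integral_density mw w0 tiltE)//; last first.
  exact/measurable_EFinP.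
rewrite (ge0_negligible_integral (measurableC mU))//; last 2 first.
- by apply/measurable_EFinP; exact: measurable_funM.
- by move=> a _; rewrite -EFinM lee_fin mulr_ge0.
rewrite setTD setCK.
rewrite (eq_integral
    (fun a => (a `^ j.+1%:R)%:E * (mom G j%:R)^-1%:E)%E); last first.
  move=> a; rewrite inE /U /= in_itv/= => /andP[a0 _].
  by rewrite -!EFinM /w !powR_mulrn// ger0_norm// exprS mulrA.
rewrite ge0_integralZr//; last 3 first.
- by apply/measurable_EFinP/measurable_funTS; exact: measurable_powR.
- by move=> a _; rewrite lee_fin powR_ge0.
- by rewrite lee_fin invr_ge0 ltW.
rewrite EFinM /mom /Rintegral fineK//.
exact: integrable_fin_num (integrable_powR G (ler0n R j.+1)).
Qed.

(** * Monotonicity and limit of the moment ratios *)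

(** Midpoint log-convexity gives [m_(j+1)^2 <= m_j * m_(j+2)]. *)
Lemma mom_ratio_nd (R : realType) (G : probability R R) :
  G `[0, 1]%classic = 1%E -> G [set 0] <> 1%E ->
  {homo (fun j : nat => mom G j.+1%:R / mom G j%:R) :
    i j / (i <= j)%N >-> i <= j}.
Proof.
move=> hG G0; have M0 j := mom_gt0 hG G0 (ler0n R j).
apply/nondecreasing_seqP => j.
have half01 : 0 < (2^-1 : R) < 1 by lra.
have jj2 : j%:R != j.+2%:R :> R by rewrite eqr_nat ltn_eqF// ltnW.
have [+ _] := ln_mom_convex hG G0 (ler0n R j) (ler0n R j.+2) jj2 half01.
rewrite (_ : 2^-1 * _ + _ = j.+1%:R); last by rewrite -!natr1; field.
move: (M0 j) (M0 j.+1) (M0 j.+2).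
move: (mom _ _) (mom _ _) (mom _ _) => c b a a0 b0 c0 h.
rewrite -ler_ln ?posrE ?divr_gt0// !ln_div ?posrE//.
by move: (ln a) (ln b) (ln c) h => {a b c a0 b0 c0} *; lra.
Qed.

(** The ratios telescope to [m_n], starting from [m_0 = 1]. *)
Lemma mom_le_expr (R : realType) (G : probability R R) (r : R) (n : nat) :
  G `[0, 1]%classic = 1%E -> G [set 0] <> 1%E ->
  (forall j : nat, mom G j.+1%:R / mom G j%:R <= r) ->
  mom G n%:R <= r ^+ n.
Proof.
move=> hG G0 ratio_le; have M0 j := mom_gt0 hG G0 (ler0n R j).
elim: n => [|n IHn]; first by rewrite mom0// expr0.
have r0 : 0 <= r by rewrite (le_trans _ (ratio_le 0%N))// ltW// divr_gt0.
rewrite exprS (le_trans (_ : _ <= r * mom G n%:R))//.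
  by rewrite -ler_pdivrMr.
by rewrite ler_wpM2l.
Qed.

(** Markov's inequality for the [n]-th moment. *)
Lemma expr_le_mom (R : realType) (G : probability R R) (c : R) (n : nat) :
  G `[0, 1]%classic = 1%E -> 0 <= c ->
  (G (`]c, +oo[%classic) * (c ^+ n)%:E <= (mom G n%:R)%:E)%E.
Proof.
move=> hG c0; rewrite -moment_mom// /moment unlock.
rewrite muleC -integral_cst//.
apply: (@le_trans _ _ (\int[G]_(a in `]c, +oo[) (a `^ n%:R)%:E)%E).
  apply: ge0_le_integral => //.
  - by move=> a _; rewrite lee_fin exprn_ge0.
  - by apply/measurable_EFinP/measurable_funTS; exact: measurable_powR.
  - move=> a; rewrite /= in_itv/= andbT => ca.
    have a0 : 0 <= a by rewrite (le_trans c0)// ltW.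
    by rewrite lee_fin powR_mulrn// lerXn2r ?nnegrE// ltW.
apply: ge0_subset_integral => //.
  by apply/measurable_EFinP; exact: measurable_powR.
by move=> a _; rewrite lee_fin powR_ge0.
Qed.

Lemma mom_ratio_cvg_ess_sup (R : realType) (G : probability R R) :
  G `[0, 1]%classic = 1%E -> G [set 0] <> 1%E ->
  (fun j : nat => (mom G j.+1%:R / mom G j%:R)%:E) @ \oo -->
    ess_sup G (fun a => a%:E).
Proof.
move=> hG G0; have M0 j := mom_gt0 hG G0 (ler0n R j).
pose u j : R := mom G j.+1%:R / mom G j%:R.
have GT0 : (0 < G setT)%E by rewrite probability_setT.
have ess_ge0 : (0 <= ess_sup G (fun a => a%:E))%E.
  apply: ess_sup_gee => //; apply: filterS (ae_unit hG) => a /=.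
  by rewrite in_itv/= lee_fin => /andP[].
have ess_le1 : (ess_sup G (fun a => a%:E) <= 1)%E.
  apply/ess_supP; apply: filterS (ae_unit hG) => a /=.
  by rewrite in_itv/= lee_fin => /andP[].
have [s sE] : exists s, ess_sup G (fun a => a%:E) = s%:E.
  exists (fine (ess_sup G (fun a => a%:E))); rewrite fineK//.
  by rewrite ge0_fin_numE// (le_lt_trans ess_le1)// ltry.
(* Almost everywhere [a <= s], so [a^(j+1) <= s * a^j]; integrate. *)
have u_le_s j : u j <= s.
  rewrite /u ler_pdivrMr// -lee_fin EFinM -!moment_mom// /moment unlock.
  have s0 : 0 <= s by rewrite -lee_fin -sE.
  rewrite -ge0_integralZl//.
  - apply: ae_ge0_le_integral => //.
    + by move=> a _; rewrite lee_fin powR_ge0.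
    + by apply/measurable_EFinP; exact: measurable_powR.
    + by move=> a _; rewrite mule_ge0// lee_fin powR_ge0.
    + apply: measurable_funeM; apply/measurable_EFinP.
      exact: measurable_powR.
    + have := ess_sup_ge G (fun a => a%:E); rewrite sE.
      move: (ae_unit hG); apply: filterS2 => a /=.
      rewrite in_itv/= => /andP[a0 _]; rewrite lee_fin => as_ _.
      by rewrite -EFinM lee_fin !powR_mulrn// exprS ler_wpM2r// exprn_ge0.
  - by apply/measurable_EFinP; exact: measurable_powR.
  - by move=> a _; rewrite lee_fin powR_ge0.
have ndu : nondecreasing_seq u by exact: mom_ratio_nd.
have ubu : has_ubound (range u) by exists s => _ [j _ <-].
have cvgu := nondecreasing_cvgn ndu ubu.
set r := sup (range u) in cvgu.
have u_le_r j : u j <= r by apply: ub_le_sup => //; exists j.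
have r_le_s : r <= s.
  by apply: ge_sup; [exists (u 0%N), 0%N | move=> _ [j _ <-]].
have r0 : 0 <= r by rewrite (le_trans _ (u_le_r 0%N))// divr_ge0// ltW.
suff -> : ess_sup G (fun a => a%:E) = r%:E.
  by apply: cvg_EFin => //; exact: nearW.
apply/eqP; rewrite eq_le sE !lee_fin r_le_s andbT -lee_fin -sE.
apply/lee_addgt0Pr => e e0; apply/ess_supP.
(* It suffices that [G] has no mass above [r + e] for each [e > 0]. That mass is at most [(r / c)^n]
   for every [n], by the two moment bounds, and [r / c < 1]. *)
set c := r + e; have c0 : 0 < c by rewrite ltr_wpDl.
suff Gc : G `]c, +oo[%classic = 0%E.
  exists `]c, +oo[%classic; split => //= a /=.
  by rewrite in_itv/= andbT lee_fin => /negP; rewrite -ltNge.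
have Gfin : G `]c, +oo[%classic \is a fin_num by exact: fin_num_measure.
rewrite -(fineK Gfin); congr EFin; apply/eqP; rewrite eq_le fine_ge0// andbT.
have cvgq : (fun n : nat => (r / c) ^+ n) @ \oo --> (0 : R).
  apply: cvg_expr; rewrite ger0_norm ?divr_ge0// ?(ltW c0)//.
  by rewrite ltr_pdivrMr// mul1r ltrDl.
rewrite -(cvg_lim _ cvgq)//; apply: limr_ge; first by apply/cvg_ex; exists 0.
apply: nearW => n; rewrite expr_div_n ler_pdivlMr ?exprn_gt0//.
rewrite (le_trans _ (mom_le_expr n hG G0 u_le_r))// -lee_fin EFinM fineK//.
by apply: expr_le_mom => //; exact: ltW.
Qed.

(** * Strict decrease of the increments and the line through the first gate *)

Lemma Delta_ln_mom (R : realType) (G : probability R R) (p0 : R) (j : nat) :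
  G `[0, 1]%classic = 1%E -> G [set 0] <> 1%E ->
  Delta G p0 j.+1 = (ln (mom G j%:R) - ln (mom G j.+1%:R))%:E.
Proof.
move=> hG G0; rewrite /Delta !ell_ln_mom//= -EFinB; congr EFin.
by move: (ln _) (ln _) => a b; ring.
Qed.

(** Strict midpoint convexity at [j], [j + 2]. At [j = 0] the left endpoint is [0], so equality
    already forces a point mass and the weaker nondegeneracy is enough. *)
Lemma ln_mom_increment_lt (R : realType) (G : probability R R) (j : nat) :
  G `[0, 1]%classic = 1%E -> G [set 0] <> 1%E ->
  ~ degenerate_off0 G \/ j = 0%N /\ ~ degenerate G ->
  ln (mom G j.+1%:R) - ln (mom G j.+2%:R) <
    ln (mom G j%:R) - ln (mom G j.+1%:R).
Proof.
move=> hG G0 ndeg.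
have half01 : 0 < (2^-1 : R) < 1 by lra.
have jj2 : j%:R != j.+2%:R :> R by rewrite eqr_nat ltn_eqF// ltnW.
have := ln_mom_convex hG G0 (ler0n R j) (ler0n R j.+2) jj2 half01.
rewrite (_ : 2^-1 * _ + _ = j.+1%:R); last by rewrite -!natr1; field.
move=> [le_mid eq_mid].
have : ln (mom G j.+1%:R) <
    2^-1 * ln (mom G j%:R) + (1 - 2^-1) * ln (mom G j.+2%:R).
  rewrite lt_neqAle le_mid andbT; apply/eqP => /eq_mid[deg0 deg].
  by case: ndeg => [|[j0]]; [exact | apply; apply: deg; rewrite j0].
move: (ln _) (ln _) (ln _) => c a b lt_mid.
by clear - lt_mid; lra.
Qed.

(** Convexity is applied to [1 = (1 - k^-1) * 0 + k^-1 * k], with [ln m_0 = 0]. *)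
Lemma ln_mom_line (R : realType) (G : probability R R) (k : R) :
  G `[0, 1]%classic = 1%E -> G [set 0] <> 1%E -> 1 < k ->
  k * ln (mom G 1) <= ln (mom G k) /\
  (k * ln (mom G 1) = ln (mom G k) -> degenerate G).
Proof.
move=> hG G0 k1; have k0 : 0 < k by rewrite (lt_trans _ k1).
have t01 : 0 < 1 - k^-1 < 1.
  by rewrite subr_gt0 invf_lt1// k1/= ltrBlDr ltrDl invr_gt0.
have k0' : 0 != k by rewrite lt_eqF.
have := ln_mom_convex hG G0 (lexx 0) (ltW k0) k0' t01.
rewrite mulr0 add0r subKr mulVf ?gt_eqF// mom0// ln1 mulr0 add0r.
move: (ln _) (ln _) => a b [le_mid eq_mid]; split.
  by rewrite mulrC -ler_pdivlMr// mulrC.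
move=> kab; have [|_] := eq_mid; last exact.
by rewrite -kab mulKf// gt_eqF.
Qed.

(** Here [k = (1 - k) * 0 + k * 1] lies between the two touching points of the line; only the
    equality case matters. *)
Lemma ln_mom_line01 (R : realType) (G : probability R R) (k : R) :
  G `[0, 1]%classic = 1%E -> G [set 0] <> 1%E -> 0 < k < 1 ->
  k * ln (mom G 1) = ln (mom G k) -> degenerate G.
Proof.
move=> hG G0 /andP[k0 k1] e.
have t01 : 0 < 1 - k < 1 by rewrite subr_gt0 k1/= ltrBlDr ltrDl.
have n01 : 0 != 1 :> R by rewrite eq_sym oner_eq0.
have [_] := ln_mom_convex hG G0 (lexx 0) ler01 n01 t01.
rewrite mulr0 add0r subKr mulr1 mom0// ln1 mulr0 add0r -e.
by move=> /(_ erefl)[_]; exact.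
Qed.

(** * Concavity of the log-odds *)

Lemma concave_ell (R : realType) (G : probability R R) (p0 : R) :
  G `[0, 1]%classic = 1%E -> concave_on `[0, +oo[%classic (ell G p0).
Proof.
move=> hG x y t; rewrite /= !in_itv/= !andbT => x0 y0 /andP[t0 t1].
(* The trivial cases [x = y], [t = 0] and [t = 1] are settled in extended arithmetic, since [ell]
   may be [+oo]; there [0 * +oo = 0]. *)
have [->|xy] := eqVneq x y.
  rewrite -mulrDl [t + _]addrC subrK mul1r -ge0_muleDl ?lee_fin ?subr_ge0//.
  by rewrite -EFinD [(t + _)%R]addrC subrK mul1e.
have [->|tn0] := eqVneq t 0.
  by rewrite mul0e add0e subr0 mul1e mul0r add0r mul1r.
have [->|tn1] := eqVneq t 1.
  by rewrite subrr mul0e adde0 mul1e mul0r addr0 mul1r.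
have t01 : 0 < t < 1.
  by rewrite lt_neqAle eq_sym tn0 t0 lt_neqAle tn1.
have tx0 : 0 <= t * x by rewrite mulr_ge0.
have ty0 : 0 <= (1 - t) * y by rewrite mulr_ge0// subr_ge0.
(* For the point mass at [0] the intermediate point is positive, so the right-hand side is [+oo]. *)
have [G0|G0] := pselect (G [set 0] = 1%E).
  rewrite [leRHS]ell_dirac0 ?leey// lt_neqAle addr_ge0// andbT eq_sym.
  rewrite paddr_eq0// !mulf_eq0 (negbTE tn0) subr_eq0.
  rewrite [1 == t]eq_sym (negbTE tn1)/=.
  by apply: contra xy => /andP[/eqP -> /eqP ->].
rewrite !ell_ln_mom ?addr_ge0// -!EFinM -EFinD lee_fin.
have [+ _] := ln_mom_convex hG G0 x0 y0 xy t01.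
move: (ln _) (ln _) (ln _) (logit _) => a b c l abc.
by clear - abc; lra.
Qed.

Lemma strictly_concave_ell (R : realType) (G : probability R R) (p0 : R) :
  G `[0, 1]%classic = 1%E -> G [set 0] <> 1%E -> ~ degenerate_off0 G ->
  strictly_concave_on `[0, +oo[%classic (ell G p0).
Proof.
move=> hG G0 ndeg x y t; rewrite /= !in_itv/= !andbT => x0 y0 xy t01.
have [le_z eq_z] := ln_mom_convex hG G0 x0 y0 xy t01.
have /andP[t0 t1] := t01.
rewrite !ell_ln_mom ?addr_ge0 ?mulr_ge0 ?subr_ge0 ?(ltW t0) ?(ltW t1)//.
rewrite -!EFinM -EFinD lte_fin.
have : ln (mom G (t * x + (1 - t) * y)) <
    t * ln (mom G x) + (1 - t) * ln (mom G y).
  by rewrite lt_neqAle le_z andbT; apply/eqP => /eq_z[].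
move: (ln _) (ln _) (ln _) (logit _) => a b c l abc.
by clear - abc; lra.
Qed.

(** * Combination of the bounds, with the point mass at 0 treated apart *)

Local Open Scope ereal_scope.

Theorem theorem3p3 (R : realType) (G : probability R R) (p0 : R)
    (hp0 : (0 < p0 < 1)%R) (hG : G `[0%R, 1%R]%classic = 1) :
  [/\ concave_on `[0%R, +oo[%classic (ell G p0),
      ~ degenerate_off0 G -> strictly_concave_on `[0%R, +oo[%classic (ell G p0),
      G [set 0%R] <> 1 ->
        [/\ forall j : nat,
              Delta G p0 j.+1 = lne (moment G j%:R / moment G j.+1%:R) /\
              Delta G p0 j.+1 = - lne (tilted_mean G j),
            forall i j : nat, (i <= j)%N -> tilted_mean G i <= tilted_mean G j
          & tilted_mean G j @[j --> \oo] --> ess_sup G (fun a => a%:E)],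
      [/\ ~ degenerate_off0 G ->
            forall i j : nat, (i < j)%N -> Delta G p0 j.+1 < Delta G p0 i.+1
        & ~ degenerate G ->
            forall j : nat, (0 < j)%N -> Delta G p0 j.+1 < Delta G p0 1]
    & [/\ forall k : R, (1 <= k)%R ->
            ell G p0 k <= (logit p0)%:E + k%:E * Delta G p0 1
        & ~ degenerate G ->
            forall k : R, (0 <= k)%R ->
              ell G p0 k = (logit p0)%:E + k%:E * Delta G p0 1 ->
              k = 0%R \/ k = 1%R]].
Proof.
(* A point mass at [0] is carried by [{0, c}] with [c = 0]. *)
have nd_off0 : ~ degenerate_off0 G -> G [set 0%R] <> 1.
  by move=> ndeg G0; apply: ndeg; exists 0%R; rewrite setUid.
have nd_n0 : ~ degenerate G -> G [set 0%R] <> 1.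
  by move=> ndeg G0; apply: ndeg; exists 0%R.
have line k : G [set 0%R] <> 1 -> (logit p0)%:E + k%:E * Delta G p0 1 =
    (logit p0 - k * ln (mom G 1))%:E.
  by move=> G0; rewrite Delta_ln_mom// mom0// ln1 sub0r -EFinM -EFinD mulrN.
split.
- exact: concave_ell.
- by move=> ndeg; exact: strictly_concave_ell (nd_off0 ndeg) ndeg.
- move=> G0; have M0 j := mom_gt0 hG G0 (ler0n R j); split.
  + move=> j; rewrite Delta_ln_mom// tilted_mean_mom// !moment_mom//.
    rewrite inver (gt_eqF (M0 _)) -EFinM !lne_EFin ?divr_gt0// !ln_div ?posrE//.
    by rewrite -EFinN opprB.
  + by move=> i j ij; rewrite !tilted_mean_mom// lee_fin; exact: mom_ratio_nd.
  + rewrite (_ : (fun j => _) = fun j : nat => (mom G j.+1%:R / mom G j%:R)%:E).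
      exact: mom_ratio_cvg_ess_sup.
    by apply/funext => j; exact: tilted_mean_mom.
- split=> [ndeg i j ij|ndeg j j0].
    have G0 := nd_off0 ndeg; rewrite !Delta_ln_mom// lte_fin.
    pose dln i := (ln (mom G i%:R) - ln (mom G i.+1%:R))%R.
    have dln_lt : {homo dln : i j / (i < j)%N >-> (j < i)%R}.
      apply: homo_ltn; first by move=> y x z /[swap]; exact: lt_trans.
      by move=> n; apply: ln_mom_increment_lt => //; left.
    exact: dln_lt.
  have G0 := nd_n0 ndeg; have M0 i := mom_gt0 hG G0 (ler0n R i).
  rewrite !Delta_ln_mom// lte_fin.
  have ltd : (ln (mom G 1%:R) - ln (mom G 2%:R) <
              ln (mom G 0%:R) - ln (mom G 1%:R))%R.
    by apply: ln_mom_increment_lt => //; right.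
  (* Only the first drop, from [Delta_1] to [Delta_2], is strict under mere nondegeneracy; monotone
     ratios give [Delta_(j+1) <= Delta_2] for [j >= 1]. *)
  apply: le_lt_trans ltd.
  rewrite -!ln_div ?posrE// ler_ln ?posrE ?divr_gt0//.
  by rewrite -lef_pV2 ?posrE ?divr_gt0// !invf_div; exact: mom_ratio_nd.
- split=> [k k1|ndeg k k0].
    (* For the point mass at [0], [Delta_1 = +oo] and [k > 0], so the line is [+oo]. *)
    have [G0|G0] := pselect (G [set 0%R] = 1).
      rewrite /Delta /= ell0 [ell G p0 1]ell_dirac0// addye// gt0_muley.
        by rewrite addey// leey.
      by rewrite lte_fin (lt_le_trans _ k1).
    rewrite line// ell_ln_mom ?(le_trans _ k1)// lee_fin lerD2l lerN2.
    move: k1; rewrite le_eqVlt => /predU1P[<-|k1]; first by rewrite mul1r.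
    by have [] := ln_mom_line hG G0 k1.
  have G0 := nd_n0 ndeg; rewrite line// ell_ln_mom// => -[] /addrI/oppr_inj e.
  (* Equality at any [k] in []0, 1[] or above [1] would be an equality case of convexity on a chord
     starting at [0], making [G] degenerate. *)
  have [k1|k1|k1] := ltgtP k 1%R; last by right.
    move: k0; rewrite le_eqVlt => /predU1P[|k0]; first by left.
    by exfalso; apply/ndeg/(@ln_mom_line01 _ _ k) => //; rewrite k0.
  by exfalso; apply: ndeg; have [_] := ln_mom_line hG G0 k1; exact.
Qed.
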